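(* Let $P$, $X$ and $Y$ be metric spaces, $F:P\times X\rightrightarrows Y$, $(\bar p,\bar x,\bar y)\in\operatorname{gph}F$, $\alpha>0$, $l>0$, and $\eta,\delta,\mu\in]0,+\infty]$. Suppose that $F$ - is $\alpha$-subregular in $x$ uniformly in $p$ at $(\bar p,\bar x,\bar y)$ with $\eta$, $\delta$ and $\mu$; - $l$-recedes in $p$ uniformly in $x$ at $(\bar p,\bar x,\bar y)$ with $\eta$, $\delta$ and $\mu':=\alpha\mu/l$. Then the mapping $G:P\rightrightarrows X$ given by $G(p):=\{x\in X\mid\bar y\in F(p,x)\}$ has the Aubin property at $(\bar p,\bar x)$ with rate $l/\alpha$, and $\eta$, $\delta$ and $\mu'$.
   Context: $B_r(z)$ denotes the open ball with center $z$ and radius $r\in]0,+\infty]$. $d(z,\Omega)=\inf_{w\in\Omega}d(z,w)$, $d(z,\emptyset)=+\infty$. $\operatorname{gph}F=\{(p,x,y)\mid y\in F(p,x)\}$. Uniform subregularity: $F$ is $\alpha$-subregular in $x$ uniformly in $p$ at $(\bar p,\bar x,\bar y)$ with $\eta,\delta,\mu$ if $\alpha\,d(x,G(p))\le d(\bar y,F(p,x))$ for all $p\in B_\eta(\bar p)$ and $x\in B_\delta(\bar x)$ with $d(\bar y,F(p,x))<\alpha\mu$. Recession: for $l>0$, $F$ $l$-recedes in $p$ uniformly in $x$ at $(\bar p,\bar x,\bar y)$ with $\eta,\delta,\mu'$ if $d(\bar y,F(p,x))\le l\,d(p,p')$ for all $x\in B_\delta(\bar x)$ and $p,p'\in B_\eta(\bar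 p)$ with $d(p,p')<\mu'$ and $\bar y\in F(p',x)$. Aubin property: $G$ has the Aubin property at $(\bar p,\bar x)\in\operatorname{gph}G$ with rate $k>0$, and $\eta,\delta,\mu'$ if $d(x,G(p))\le k\,d(p,p')$ for all $p,p'\in B_\eta(\bar p)$ with $d(p,p')<\mu'$, and all $x\in G(p')\cap B_\delta(\bar x)$. *)

(* Defs.v *)
From HB Require Import structures.
From mathcomp Require Import all_boot all_order all_algebra.
From mathcomp Require Import all_classical all_reals all_analysis.

Set Implicit Arguments.
Unset Strict Implicit.
Unset Printing Implicit Defensive.

Import Order.TTheory GRing.Theory Num.Theory.

Local Open Scope classical_set_scope.
Local Open Scope ring_scope.
Local Open Scope ereal_scope.

(* The library's [ball] only takes radii in [R]; here the radius may be +oo. *)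
Definition eball (R : realType) (M : metricType R) (z : M) (r : \bar R) : set M :=
  [set w | (mdist z w)%:E < r].

(* The infimum is taken in [\bar R], so that the distance to [set0] is +oo. *)
Definition dist_set (R : realType) (M : metricType R) (z : M) (A : set M) : \bar R :=
  ereal_inf [set (mdist z w)%:E | w in A].

(* A set-valued mapping S from T to U is a function [T -> set U]. For
   [F : P * X -> set Y], [gph F] contains triples [(p, x, y)]. *)
Definition gph (T U : Type) (S : T -> set U) : set (T * U) :=
  [set z | S z.1 z.2].

Definition solution_map (P X Y : Type) (F : P * X -> set Y) (ybar : Y) :
    P -> set X :=
  fun p => [set x | F (p, x) ybar].

Definition uniformly_subregular (R : realType) (P X Y : metricType R)
    (F : P * X -> set Y) (alpha : R) (pbar : P) (xbar : X) (ybar : Y)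
    (eta delta mu : \bar R) : Prop :=
  forall (p : P) (x : X), eball pbar eta p -> eball xbar delta x ->
    dist_set ybar (F (p, x)) < alpha%:E * mu ->
    alpha%:E * dist_set x (solution_map F ybar p) <= dist_set ybar (F (p, x)).

Definition uniformly_recedes (R : realType) (P X Y : metricType R)
    (F : P * X -> set Y) (l : R) (pbar : P) (xbar : X) (ybar : Y)
    (eta delta mu' : \bar R) : Prop :=
  forall (x : X) (p p' : P), eball xbar delta x ->
    eball pbar eta p -> eball pbar eta p' ->
    (mdist p p')%:E < mu' -> F (p', x) ybar ->
    dist_set ybar (F (p, x)) <= (l * mdist p p')%:E.

Definition Aubin_property (R : realType) (P X : metricType R)
    (G : P -> set X) (pbar : P) (xbar : X) (k : R)
    (eta delta mu' : \bar R) : Prop :=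
  [/\ gph G (pbar, xbar),
      (0 < k)%R &
      forall (p p' : P) (x : X), eball pbar eta p -> eball pbar eta p' ->
        (mdist p p')%:E < mu' -> (G p' `&` eball xbar delta) x ->
        dist_set x (G p) <= (k * mdist p p')%:E].

(* Main.v *)
Require Import Defs.
From HB Require Import structures.
From mathcomp Require Import all_boot all_order all_algebra.
From mathcomp Require Import all_classical all_reals all_analysis.
Import Order.TTheory GRing.Theory Num.Theory.
Local Open Scope classical_set_scope.
Local Open Scope ring_scope.
Local Open Scope ereal_scope.

(** For [x] in [G p'], recession bounds the residual [dist_set ybar (F (p, x))] by [l * mdist p p'];
    subregularity at [p] turns this residual into a bound on the distance from [x] to [G p], at the
    cost of a factor [1 / alpha]. *)

Theorem proposition5p11 (R : realType) (P X Y : metricType R)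
    (F : P * X -> set Y) (pbar : P) (xbar : X) (ybar : Y)
    (alpha l : R) (eta delta mu : \bar R)
    (gphF : gph F (pbar, xbar, ybar))
    (alpha_gt0 : (0 < alpha)%R) (l_gt0 : (0 < l)%R)
    (eta_gt0 : 0 < eta) (delta_gt0 : 0 < delta) (mu_gt0 : 0 < mu)
    (subregF : uniformly_subregular F alpha pbar xbar ybar eta delta mu)
    (recF : uniformly_recedes F l pbar xbar ybar eta delta
              (alpha%:E * mu / l%:E)) :
  Aubin_property (solution_map F ybar) pbar xbar (l / alpha)%R eta delta
    (alpha%:E * mu / l%:E).
Proof.
split=> // [|p p' x pB p'B pp' [Gp'x xB]]; first exact: divr_gt0.
have rec := recF x p p' xB pB p'B pp' Gp'x.
(* The radius [alpha * mu / l] is exactly what keeps the recession bound, hence the residual, below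
   the subregularity threshold. *)
have lpp' : (l * mdist p p')%:E < alpha%:E * mu.
  (* [inver] sends 0 to +oo; as [l] is positive, the inverse is the real one, and [mu] may still be
     +oo. *)
  by move: pp'; rewrite inver gt_eqF // lte_pdivlMr // muleC EFinM.
have := le_trans (subregF p x pB xB (le_lt_trans rec lpp')) rec.
(* Only the real [alpha] is divided out, so the distance to [G p] need not be known finite
   beforehand. *)
by rewrite muleC -lee_pdivlMr // -EFinM mulrAC.
Qed.
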